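(* Let $X$ be a real Banach space and let $F\subseteq X^*$ be a norming subspace. The following statements are equivalent: (i) $X$ admits an equivalent $\sigma(X,F)$-lower semicontinuous rotund norm; (ii) $X$ admits an equivalent $\sigma(X,F)$-lower semicontinuous norm such that, denoting by $S_X$ its unit sphere, there is a symmetric $\rho$ defined on $S_X$ with the property that for every $x\in S_X$ and every $\varepsilon>0$ there is a $\sigma(X,F)$-open slice of $S_X$ containing $x$ and having $\rho$-diameter less than $\varepsilon$; (iii) $X$ admits an equivalent $\sigma(X,F)$-lower semicontinuous norm such that, denoting by $S_X$ its unit sphere, $(S_X,\sigma(X,F))$ has a $\mathcal{G}_\delta$-diagonal sequence $(\mathcal{G}_n)_{n\in\mathbb{N}}$ such that every element of every $\mathcal{G}_n$ is a $\sigma(X,F)$-open slice of $S_X$.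
   Context: $\sigma(X,F)$ is the topology on $X$ of pointwise convergence on $F$. A subset $B\subseteq B_{X^*}$ is norming if $\|x\|_B=\sup_{b^*\in B}|b^*(x)|$ is a norm on $X$ equivalent to the original one; a subspace $F\subseteq X^*$ is norming if $F\cap B_{X^*}$ is norming. A norm is rotund (strictly convex) if $\|x\|=\|y\|=\|(x+y)/2\|$ implies $x=y$. A $\sigma(X,F)$-open slice of a set $A\subseteq X$ is the intersection of $A$ with a $\sigma(X,F)$-open half-space $\{x\in X: f(x)>\alpha\}$, where $f\in F$, $f\neq 0$, $\alpha\in\mathbb{R}$. A symmetric on a nonempty set $T$ is a function $\rho:T\times T\to[0,+\infty)$ with $\rho(x,y)=\rho(y,x)$ for all $x,y\in T$, and $\rho(x,y)=0$ if and only if $x=y$ (no triangle inequality is assumed, and no relation with any topology on $T$). The $\rho$-diameter of $D\subseteq T$ is $\sup\{\rho(x,y):x,y\in D\}$. A $\mathcal{G}_\delta$-diagonal sequence for a topological space $T$ is a sequence $(\mathcal{G}_n)_{n\in\mathbb{N}}$ of open covers of $T$ such that for all $x,y\in T$ with $x\neq y$ there exists $n\in\mathbb{N}$ with $y\notin\mathrm{St}(x,\mathcal{G}_n)$, where $\mathrm{St}(x,\mathcal{G}_n)=\bigcup\{U\in\mathcal{G}_n:x\in U\}$. *)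

(* Defs.v *)
From HB Require Import structures.
From mathcomp Require Import all_boot all_order all_algebra.
From mathcomp Require Import all_classical all_reals all_analysis.

Set Implicit Arguments.
Unset Strict Implicit.
Unset Printing Implicit Defensive.

Import Order.TTheory GRing.Theory Num.Theory.
Import numFieldNormedType.Exports.

Local Open Scope classical_set_scope.
Local Open Scope ring_scope.

Section duality.
Context {R : realType} {X : normedModType R}.

(* Functionals take values in [R^o], i.e. [R] seen as a module over itself;
   this makes [X -> R^o] an [lmodType R]. *)
Definition dual : set (X -> R^o) := [set f | linear f /\ continuous f].

Definition dual_norm (f : X -> R^o) : R :=
  sup [set (`|f x| : R) | x in [set x : X | `|x| <= 1]].

Definition dual_ball : set (X -> R^o) := [set f | dual f /\ dual_norm f <= 1].

(* Nonnegativity follows from the three axioms, which are those of the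
   library factory [Lmodule_isNormed]. *)
Definition is_norm (N : X -> R) : Prop :=
  [/\ forall x y, N (x + y) <= N x + N y,
      forall (a : R) x, N (a *: x) = `|a| * N x
    & forall x, N x = 0 -> x = 0].

Definition equivalent_norm (N : X -> R) : Prop :=
  is_norm N /\
  exists c C : R, [/\ 0 < c, 0 < C & forall x, c * `|x| <= N x <= C * `|x|].

Definition norm_on (B : set (X -> R^o)) (x : X) : R :=
  sup [set (`|b x| : R) | b in B].

Definition norming (B : set (X -> R^o)) : Prop :=
  B `<=` dual_ball /\ equivalent_norm (norm_on B).

Definition norming_subspace (F : set (X -> R^o)) : Prop :=
  [/\ F `<=` dual, submod_closed [in F] & norming (F `&` dual_ball)].

(* sigma(X, F): the initial topology of [x |-> (f x)_(f in F)], the space of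
   all functions [F -> R] having the topology of pointwise convergence. *)
Definition sigma_topology (F : set (X -> R^o)) : topologicalType :=
  initial_topology (fun x : X => (fun f => set_val f x) : {ptws F -> R}).

Definition sigma_lsc (F : set (X -> R^o)) (N : X -> R) : Prop :=
  lower_semicontinuous (fun x : sigma_topology F => (N x)%:E).

Definition rotund (N : X -> R) : Prop :=
  forall x y, N x = N y -> N y = N (2^-1 *: (x + y)) -> x = y.

Definition sphere (N : X -> R) : set X := [set x | N x = 1].

(* [sphere N] as a type, with the subspace topology of sigma(X, F). *)
Definition sigma_sphere (F : set (X -> R^o)) (N : X -> R) : topologicalType :=
  (sphere N : set (sigma_topology F)).

Definition open_half_space (f : X -> R^o) (alpha : R) : set X :=
  [set x | alpha < (f x : R)].

Definition open_slice (F : set (X -> R^o)) (A D : set X) : Prop :=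
  exists f alpha,
    [/\ F f, f <> (fun=> 0) & D = A `&` open_half_space f alpha].

(* [open_slice] for a subset [D] of the sphere regarded as a type. *)
Definition sphere_slice (F : set (X -> R^o)) (N : X -> R)
    (D : set (sigma_sphere F N)) : Prop :=
  open_slice F (sphere N) [set set_val p | p in D].

End duality.

Definition symmetric_on (R : realType) (T : Type) (rho : T -> T -> R) : Prop :=
  [/\ forall x y, 0 <= rho x y,
      forall x y, rho x y = rho y x
    & forall x y, rho x y = 0 <-> x = y].

(* The supremum is taken in the extended reals: [rho] need not be bounded. *)
Definition diam (R : realType) (T : Type) (rho : T -> T -> R) (D : set T) :
    \bar R :=
  ereal_sup [set (rho x y)%:E | x in D & y in D].

Definition open_cover (T : topologicalType) (G : set (set T)) : Prop :=
  G `<=` open /\ cover G id = [set: T].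

Definition star (T : Type) (x : T) (G : set (set T)) : set T :=
  \bigcup_(U in [set U | G U /\ U x]) U.

Definition Gdelta_diagonal_sequence (T : topologicalType)
    (G : nat -> set (set T)) : Prop :=
  (forall n, open_cover (G n)) /\
  (forall x y : T, x <> y -> exists n, ~ star x (G n) y).

(* Main.v *)
From HB Require Import structures.
Require Import Defs.
From mathcomp Require Import all_boot all_order all_algebra.
From mathcomp Require Import all_classical all_reals all_analysis.
From mathcomp Require Import ring lra.
Import Order.TTheory GRing.Theory Num.Theory.
Import numFieldNormedType.Exports.
Local Open Scope classical_set_scope.
Local Open Scope ring_scope.

(* For (i) => (ii), rho x y = 1 - N ((x + y) / 2) is a symmetric by rotundity, and
   a slice {f > 1 - e} with f in F and f <= N has rho-diameter at most e; such an f
   exists near every point of the sphere because a sigma(X, F)-lower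
   semicontinuous norm is the supremum of the elements of F that it dominates.
   For (ii) => (iii), take the slices of rho-diameter less than 1/(n+1).

   For (iii) => (i), let p n be the supremum of the sublinear functions
   f + (3 - a) N over the normalized pairs (f, a) for which {f > a} cuts off a part
   of the sphere lying in one element of G n.  On the sphere this is
   3 + sup (f - a), which exceeds 3 since the slices cover.  If
   p n (x + y) = p n x + p n y for x, y in the sphere, an almost optimal pair at
   x + y is almost optimal at x and at y, so f x > a and f y > a, and y is in the
   star of x.  Hence, symmetrized, the sum of the p n / 2^(n+1) is rotund. *)

Set Implicit Arguments.
Unset Strict Implicit.
Unset Printing Implicit Defensive.

(** * Sublinear functionals and a Hahn-Banach theorem with finitely many constraints *)

Definition sublinear {R : realType} {V : lmodType R} (P : V -> R) : Prop :=
  (forall x y, P (x + y) <= P x + P y) /\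
  (forall (t : R) x, 0 <= t -> P (t *: x) = t * P x).

Section sublinear.
Context {R : realType} {V : lmodType R}.
Implicit Types (P : V -> R) (F : set (V -> R^o)).

Lemma sublinearP P : (forall x y, P (x + y) <= P x + P y) ->
  (forall (t : R) x, 0 < t -> P (t *: x) <= t * P x) -> sublinear P.
Proof.
move=> PD PZ; split=> // t x; rewrite le_eqVlt => /predU1P[<-|t0].
  (* The factors 2 and 1/2 give [P 0 <= 2 * P 0] and [P 0 <= P 0 / 2], hence [P 0 = 0]. *)
  have := PZ 2 0 (ltr0Sn _ 1); have := PZ 2^-1 0; rewrite invr_gt0 ltr0Sn !scaler0.
  by rewrite scale0r mul0r => /(_ isT) ? ?; lra.
apply/le_anti/andP; split; first exact: PZ.
have := PZ t^-1 (t *: x); rewrite invr_gt0 scalerA mulVf ?gt_eqF// scale1r.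
by move=> /(_ t0); rewrite ler_pdivlMl.
Qed.

Lemma sublinear0 P : sublinear P -> P 0 = 0.
Proof. by move=> [_ /(_ 0 0 (lexx _))]; rewrite scaler0 mul0r. Qed.

Lemma sublinear_geN P x : sublinear P -> - P (- x) <= P x.
Proof.
move=> sP; have := sP.1 x (- x); rewrite subrr sublinear0//; lra.
Qed.

(** [E] acts as an epigraph: stability under sums and positive multiples makes it a convex cone,
    whose lower boundary is sublinear. Flattening and infimal convolution are both built this
    way. *)
Lemma sublinear_inf (E : V -> R -> Prop) :
  (forall x, exists r, E x r) ->
  (forall x, exists b, forall r, E x r -> b <= r) ->
  (forall x y r s, E x r -> E y s -> E (x + y) (r + s)) ->
  (forall (t : R) x r, 0 < t -> E x r -> E (t *: x) (t * r)) ->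
  sublinear (fun x => inf [set r | E x r]).
Proof.
move=> E0 Eb ED EZ.
have lb x : has_lbound [set r | E x r] by have [b] := Eb x; exists b.
have infE x b : (forall r, E x r -> b <= r) -> b <= inf [set r | E x r].
  by move=> bE; apply: lb_le_inf => //; exact: E0.
apply: sublinearP => [x y|t x t0].
  rewrite -lerBlDr; apply: (infE) => r xr.
  rewrite lerBlDr -lerBlDl; apply: (infE) => s ys.
  by rewrite lerBlDl; apply: ge_inf => //; exact: ED.
rewrite -ler_pdivrMl//; apply: (infE) => r xr.
by rewrite ler_pdivrMl//; apply: ge_inf => //; exact: EZ.
Qed.

(* [Q] is the infimum of [P (x + t *: v) - t * P v] over [0 <= t]. *)
Lemma sublinear_flatten P v : sublinear P ->
  exists Q, [/\ sublinear Q, forall x, Q x <= P x & forall t, Q (t *: v) = t * P v].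
Proof.
move=> sP; pose E x r := exists2 t : R, 0 <= t & P (x + t *: v) - t * P v <= r.
have Eb x : lbound [set r | E x r] (- P (- x)).
  move=> r [t t0]; have := sP.1 (x + t *: v) (- x).
  by rewrite addrAC subrr add0r sP.2//; lra.
pose Q x := inf [set r | E x r].
have sQ : sublinear Q.
  apply: sublinear_inf => [x|x|x y r s [t t0 tr] [u u0 us]|t x r t0 [u u0 ur]].
  - by exists (P x), 0; rewrite ?scale0r ?addr0 ?mul0r ?subr0.
  - by exists (- P (- x)) => r /Eb.
  - exists (t + u); first exact: addr_ge0.
    rewrite scalerDl addrACA.
    have := sP.1 (x + t *: v) (y + u *: v); lra.
  - exists (t * u); first by rewrite mulr_ge0// ltW.
    rewrite -scalerA -scalerDr (sP.2 _ _ (ltW t0)) -mulrA -mulrBr.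
    by rewrite ler_pM2l.
have Qle x t : 0 <= t -> Q x <= P (x + t *: v) - t * P v.
  by move=> t0; apply: ge_inf; [exists (- P (- x)); exact: Eb|exists t].
exists Q; split=> // [x|t].
  by have := Qle x 0 (lexx _); rewrite scale0r addr0 mul0r subr0.
(* Taking [t = 1] in the infimum at [- v] gives [Q (- v) <= - P v]. With [- Q (- v) <= Q v <= P v]
   this forces equality throughout. *)
have Qv : Q v = P v.
  apply/le_anti/andP; split.
    by have := Qle v 0 (lexx _); rewrite scale0r addr0 mul0r subr0.
  have := sublinear_geN v sQ; have := Qle (- v) 1 ler01.
  by rewrite scale1r addNr sublinear0//; lra.
have QNv : Q (- v) = - P v.
  have := sublinear_geN v sQ; have := Qle (- v) 1 ler01.
  rewrite scale1r addNr sublinear0//; lra.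
have [t0|t0] := leP 0 t; first by rewrite sQ.2// Qv.
have := sQ.2 (- t) (- v); rewrite scalerN scaleNr opprK => ->.
  by rewrite QNv mulrNN.
by rewrite oppr_ge0 ltW.
Qed.

Lemma sublinear_dominated F P (s : seq (V -> R^o)) :
  submod_closed [in F] -> (forall f, F f -> linear f) -> sublinear P ->
  (forall f, f \in s -> F f) ->
  (forall x, (forall f, f \in s -> f x = 0) -> P x <= 0) ->
  exists2 g, F g & forall x, g x <= P x.
Proof.
move=> [F0 FZ] linF; elim: s P => [|f s IH] P sP sF Ps.
  (* With no constraint left, [P <= 0] everywhere, so [0 <= - P (- x) <= P x]. *)
  exists 0 => [|x]; first by rewrite -in_setE.
  have -> : (0 : V -> R^o) x = 0 :> R by [].
  have := sublinear_geN x sP; have := Ps (- x); rewrite -oppr_ge0 => PNx.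
  by apply: le_trans; exact: PNx.
have Ff : F f by apply: sF; rewrite mem_head.
have sF' g : g \in s -> F g by move=> gs; apply: sF; rewrite in_cons gs orbT.
have fZ a x y : f (a *: x + y) = a * f x + f y by exact: linF.
have [[v vs fv0]|nv] := pselect (exists2 v, forall g, g \in s -> g v = 0 & f v != 0);
  last first.
  apply: IH => // x xs; apply: Ps => g; rewrite in_cons => /predU1P[->|]; last exact: xs.
  by apply: contrapT => fx; apply: nv; exists x => //; exact/eqP.
have [Q [sQ QP Qv]] := sublinear_flatten (P := P) v sP.
(* Chosen so that [c * f] and [Q] agree on the line through [v]. *)
pose c : R := P v / f v.
have [g Fg gQ] : exists2 g, F g & forall x, g x <= Q x - c * f x.
  apply: (IH (fun x => Q x - c * f x)) => // [|x xs].
    split=> [x y|t x t0].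
      have := sQ.1 x y; have := fZ 1 x y.
      by rewrite scale1r mul1r => ->; rewrite mulrDr; lra.
    have := fZ 1 0 0; rewrite scale1r addr0 mul1r -[LHS]addr0 => /addrI f0.
    by have := fZ t x 0; rewrite addr0 sQ.2// => ->; rewrite -f0; ring.
  (* Subtracting [a *: v] moves [x] into the kernel of [f] without leaving those of [s], where
     [P <= 0]; hence [Q x <= Q (a *: v) = c * f x]. *)
  pose a : R := f x / f v.
  have Pz : P (- a *: v + x) <= 0.
    apply: Ps => h; rewrite in_cons => /predU1P[->|hs].
      by rewrite fZ /a mulNr divfK// addNr.
    have -> : h (- a *: v + x) = - a * h v + h x by exact: (linF _ (sF' _ hs)).
    by rewrite vs// xs// mulr0 addr0.
  have := sQ.1 (a *: v) (- a *: v + x); have := QP (- a *: v + x).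
  rewrite addrA -scalerDl subrr scale0r add0r Qv.
  have -> : c * f x = a * P v by rewrite /c /a mulrC -[RHS]mulrA [_^-1 * _]mulrC.
  lra.
exists (c *: f + g) => [|x].
  by rewrite -in_setE; apply: FZ; rewrite in_setE.
have -> : (c *: f + g) x = c * f x + g x :> R by [].
have := gQ x; have := QP x; lra.
Qed.

Lemma sublinear_sup (T : Type) (I : set T) (P : T -> V -> R) :
  I !=set0 -> (forall x, has_ubound [set P i x | i in I]) ->
  (forall i, I i -> sublinear (P i)) ->
  sublinear (fun x => sup [set P i x | i in I]).
Proof.
move=> [i0 Ii0] ubP sP.
have Ple i x : I i -> P i x <= sup [set P i x | i in I].
  by move=> Ii; apply: ub_le_sup => //; exists i.
have supP x b : (forall i, I i -> P i x <= b) -> sup [set P i x | i in I] <= b.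
  move=> Pb; apply: ge_sup => [|_ [i Ii <-]]; last exact: Pb.
  by exists (P i0 x), i0.
apply: sublinearP => [x y|t x t0]; apply: (supP) => i Ii.
  by apply: le_trans ((sP i Ii).1 _ _) _; rewrite lerD// Ple.
by rewrite (sP i Ii).2 ?(ltW t0)// ler_wpM2l ?(ltW t0)// Ple.
Qed.

(** For [a <= b], subadditivity on [b *: (x + y) = (a *: x + b *: y) + (b - a) *: x] gives the
    missing inequality. It lets additivity at [x, y] pass to their normalizations. *)
Lemma sublinear_additive_cone (P : V -> R) x y (a b : R) :
  sublinear P -> P (x + y) = P x + P y -> 0 <= a -> 0 <= b ->
  P (a *: x + b *: y) = a * P x + b * P y.
Proof.
move=> sP; wlog ab : a b x y / a <= b.
  move=> H; have [ab|/ltW ba] := leP a b; first exact: H.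
  by move=> Pxy a0 b0; rewrite addrC [RHS]addrC; apply: H => //; rewrite addrC Pxy addrC.
move=> Pxy a0 b0; apply/le_anti/andP; split.
  by apply: le_trans (sP.1 _ _) _; rewrite !sP.2.
have := sP.1 (a *: x + b *: y) ((b - a) *: x).
have -> : a *: x + b *: y + (b - a) *: x = b *: (x + y).
  by rewrite addrAC -scalerDl [a + _]addrC subrK scalerDr.
rewrite [P (b *: _)]sP.2// [P ((b - a) *: _)]sP.2 ?subr_ge0// Pxy; lra.
Qed.

End sublinear.

(** * Linear functionals and the topology sigma(X, F) *)

(** Elements of [F] are bare functions; bundling them gives access to the rewriting rules for linear
    maps. *)
Lemma linear_packed {R : realType} {V : lmodType R} (f : V -> R^o) :
  linear f -> exists g : {linear V -> R^o}, f = g.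
Proof.
move=> lf; pose lin := GRing.isLinear.Build R V R^o _ f lf.
by exists (HB.pack_for {linear V -> R^o} f lin).
Qed.

Lemma dual_bounded {R : realType} {X : normedModType R} (f : X -> R^o) : dual f ->
  exists2 B : R, 0 < B & forall x, `|f x : R| <= B * `|x|.
Proof.
move=> [linf cf]; have [g fg] := linear_packed linf; subst f.
have /(continuous_linear_bounded 0)/linear_boundedP/pinfty_ex_gt0[B B0 gB] :
  {for 0, continuous g} by exact: cf.
by exists B.
Qed.

Section sigma_topology.
Context {R : realType} {X : normedModType R}.
Variable F : set (X -> R^o).
Local Notation sX := (sigma_topology F).

Lemma sigma_cvg (G : set_system X) (x : sX) : Filter G ->
  (forall f, F f -> (fun y => f y : R) @ G --> (f x : R)) -> G --> x.
Proof.
move=> GF cvF A [_ [[W oW <-] Wx] sWA]; apply: (filterS sWA).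
pose ev (y : X) : {ptws F -> R} := fun f => set_val f y.
have : ev @ G --> ev x.
  apply/cvg_sup => -[f fF] B [_ [[U oU <-] Uf] sUB].
  apply: (filterS sUB); apply: (cvF f (set_mem fF)); exact: open_nbhs_nbhs.
by apply; exact: open_nbhs_nbhs.
Qed.

Lemma sigma_continuous f : F f -> continuous (fun x : sX => f x : R).
Proof.
move=> Ff x A fA.
apply: (@initial_continuous X {ptws F -> R} (fun y f => set_val f y) x
  [set g | A (g (SigSub (mem_set Ff)))]).
exact: (@proj_continuous F (fun=> R) (SigSub (mem_set Ff))).
Qed.

Lemma sigma_continuousN : (forall f, F f -> linear f) ->
  continuous ((fun x => - x) : sX -> sX).
Proof.
move=> linF x; apply: sigma_cvg => [|f Ff].
  exact: (@fmap_filter sX sX (fun y : X => - y) (nbhs x) (nbhs_filter x)).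
have fN y : f (- y) = - f y by have [g ->] := linear_packed (linF f Ff); rewrite linearN.
have : (fun y : sX => - (f y : R)) @ x --> - (f x : R).
  exact: (@cvgN R R sX (nbhs x) (nbhs_filter x) (fun y => f y : R) (f x)
    (sigma_continuous Ff (x := x))).
rewrite (_ : (fun y => - (f y : R)) = (fun y => f (- y))) ?fN//.
by apply/funext => y; rewrite fN.
Qed.

(** The sets containing such a basic neighbourhood form a filter that converges to [x] pointwise on
    [F], so it contains every neighbourhood of [x]. *)
Lemma sigma_nbhsP (x : sX) (A : set X) : nbhs x A ->
  exists2 s : seq (X -> R^o), (forall f, f \in s -> F f) &
  exists2 d : R, 0 < d &
    forall y, (forall f, f \in s -> `|f x - f y : R| < d) -> A y.
Proof.
pose G : set_system X := [set A |
  exists2 s : seq (X -> R^o), (forall f, f \in s -> F f) &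
  exists2 d : R, 0 < d &
    forall y, (forall f, f \in s -> `|f x - f y : R| < d) -> A y].
have GF : Filter G.
  split.
  - by exists nil => //; exists 1.
  - move=> B C [s sF [d d0 sB]] [u uF [e e0 uC]].
    exists (s ++ u) => [f|]; first by rewrite mem_cat => /orP[/sF|/uF].
    exists (Num.min d e) => [|y suy]; first by rewrite lt_min d0.
    split; [apply: sB|apply: uC] => f fs; have := suy f.
      by rewrite mem_cat fs lt_min => /(_ isT) /andP[].
    by rewrite mem_cat fs orbT lt_min => /(_ isT) /andP[].
  - move=> B C BC [s sF [d d0 sB]]; exists s => //; exists d => // y /sB; exact: BC.
suff : G --> x by exact.
apply: sigma_cvg => f Ff; apply/cvgrPdist_lt => e e0.
exists [:: f] => [g|]; first by rewrite inE => /eqP ->.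
by exists e => // y; apply; rewrite inE.
Qed.

Lemma sigma_lscP (N : X -> R) : sigma_lsc F N <->
  forall (x : sX) a, a < N x -> \forall y \near x, a < N y.
Proof.
split=> lscN x a aN.
  have [|V Vx NV] := lscN x a; first by rewrite lte_fin.
  by apply: (@filterS sX (nbhs x) (nbhs_filter x) V) => // y /NV; rewrite lte_fin.
exists [set y | a < N y]; last by move=> y; rewrite lte_fin.
by apply: lscN; rewrite -lte_fin.
Qed.

Lemma sigma_lscD (N1 N2 : X -> R) : sigma_lsc F N1 -> sigma_lsc F N2 ->
  sigma_lsc F (fun x => N1 x + N2 x).
Proof.
move=> /sigma_lscP lN1 /sigma_lscP lN2; apply/sigma_lscP => x a aN.
have : \forall y \near x, N1 x - (N1 x + N2 x - a) / 2 < N1 y by apply: lN1; lra.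
have : \forall y \near x, N2 x - (N1 x + N2 x - a) / 2 < N2 y by apply: lN2; lra.
by apply: filterS2 => y; lra.
Qed.

Lemma sigma_lscZ (c : R) (N : X -> R) : 0 < c -> sigma_lsc F N ->
  sigma_lsc F (fun x => c * N x).
Proof.
move=> c0 /sigma_lscP lN; apply/sigma_lscP => x a.
by rewrite -ltr_pdivrMl// => /lN; apply: filterS => y; rewrite ltr_pdivrMl.
Qed.

Lemma sigma_lsc_sup (T : Type) (I : set T) (N : T -> X -> R) :
  I !=set0 -> (forall x, has_ubound [set N i x | i in I]) ->
  (forall i, I i -> sigma_lsc F (N i)) ->
  sigma_lsc F (fun x => sup [set N i x | i in I]).
Proof.
move=> [i0 Ii0] ubN lN; apply/sigma_lscP => x a.
move=> /sup_gt[|_ [i Ii <-]]; first by exists (N i0 x), i0.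
move=> /(proj1 (sigma_lscP _) (lN i Ii)); apply: filterS => y /lt_le_trans; apply.
by apply: ub_le_sup => //; exists i.
Qed.

Lemma sigma_lsc_continuous (f : X -> R) : continuous (f : sX -> R) -> sigma_lsc F f.
Proof.
move=> cf; apply/sigma_lscP => x a afx.
exact: (@cvgr_gt R sX (nbhs x) (nbhs_filter x) f (f x) (cf x) a afx).
Qed.

Lemma sigma_lscN (N : X -> R) : (forall f, F f -> linear f) ->
  sigma_lsc F N -> sigma_lsc F (fun x => N (- x)).
Proof.
move=> linF /sigma_lscP lN; apply/sigma_lscP => x a /lN.
exact: sigma_continuousN.
Qed.

End sigma_topology.

(** * Lower semicontinuous norms as suprema of elements of [F] *)

Section separation.
Context {R : realType} {X : normedModType R}.
Implicit Types (N : X -> R) (F : set (X -> R^o)).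

Lemma norm_sublinear N : is_norm N -> sublinear N.
Proof. by move=> [ND NZ _]; split=> // t x t0; rewrite NZ ger0_norm. Qed.

Lemma is_normN N x : is_norm N -> N (- x) = N x.
Proof. by move=> [_ NZ _]; rewrite -scaleN1r NZ normrN1 mul1r. Qed.

Lemma is_norm_ge0 N x : is_norm N -> 0 <= N x.
Proof.
move=> nN; have := sublinear_geN x (norm_sublinear nN); rewrite is_normN//; lra.
Qed.

(* Hahn-Banach for a lower semicontinuous norm: semicontinuity at [x] only
   involves finitely many elements of [F], so that the infimal convolution of
   [N] with a multiple of the sum of their absolute values is at least [b] at
   [x] and vanishes where they all vanish. *)
Lemma sigma_lsc_separation F N x (a : R) :
  submod_closed [in F] -> (forall f, F f -> linear f) ->
  is_norm N -> sigma_lsc F N -> a < N x ->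
  exists f, [/\ F f, forall y, f y <= N y & a < f x].
Proof.
move=> subF linF nN /sigma_lscP lN aN.
have sN := norm_sublinear nN.
pose b := (a + N x) / 2.
have /lN/sigma_nbhsP [s sF [d d0 sb]] : b < N x by rewrite /b; lra.
(* The factor makes [q z >= |b|] as soon as the sum reaches [d]. *)
pose q z := `|b| / d * \sum_(f <- s) `|f z : R|.
have q0 z : 0 <= q z by rewrite mulr_ge0 ?sumr_ge0// divr_ge0// ltW.
have sq : sublinear q.
  split=> [y z|t z t0]; rewrite /q.
    rewrite -mulrDr ler_wpM2l ?divr_ge0 ?(ltW d0)// -big_split big_seq [leRHS]big_seq.
    apply: ler_sum => f /sF Ff; have [g ->] := linear_packed (linF f Ff).
    by rewrite linearD ler_normD.
  rewrite mulrCA; congr (_ * _); rewrite mulr_sumr !big_seq.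
  apply: eq_bigr => f /sF Ff; have [g ->] := linear_packed (linF f Ff).
  by rewrite linearZ normrM (ger0_norm t0).
pose E z r := exists u, N u + q (z - u) <= r.
pose P z := inf [set r | E z r].
have Eb z : lbound [set r | E z r] 0.
  by move=> r [u]; apply: le_trans; rewrite addr_ge0// is_norm_ge0.
have sP : sublinear P.
  apply: sublinear_inf => [z|z|y z r t [u ur] [v vt]|t z r t0 [u ur]].
  - by exists (N z + q (z - z)), z.
  - by exists 0 => r /Eb.
  - exists (u + v); have := sN.1 u v; have := sq.1 (y - u) (z - v).
    by rewrite opprD addrACA; lra.
  - exists (t *: u); rewrite sN.2 ?(ltW t0)// -scalerBr sq.2 ?(ltW t0)//.
    by rewrite -mulrDr ler_pM2l.
have Ple z u : P z <= N u + q (z - u).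
  by apply: ge_inf; [exists 0; exact: Eb|exists u].
have Px : b <= P x.
  apply: lb_le_inf => [|r [u]]; first by exists (N x + q (x - x)), x.
  apply: le_trans.
  (* Either [u] is in the neighbourhood of [x] where [N > b], or [q (x - u)] alone is at least
     [b]. *)
  have [xu|xu] := ltP (\sum_(f <- s) `|f (x - u) : R|) d.
    rewrite (@le_trans _ _ (N u))// ?lerDl//; apply/ltW/sb => f fs.
    apply: le_lt_trans xu.
    have [g fg] := linear_packed (linF f (sF f fs)).
    have -> : f x - f u = f (x - u) by rewrite fg linearB.
    by rewrite (big_rem f)//= lerDl sumr_ge0.
  rewrite (@le_trans _ _ (q (x - u)))// ?lerDr ?is_norm_ge0//.
  rewrite (le_trans (ler_norm b))// /q -mulrA ler_peMr// ler_pdivlMl//.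
  by rewrite mulr1.
(* Flattening along [x] gives [Q (- x) = - P x], so that any linear [g <= Q] satisfies
   [g x >= P x >= b > a]. *)
have [Q [sQ QP Qx]] := sublinear_flatten x sP.
have [g Fg gQ] : exists2 g, F g & forall x, g x <= Q x.
  apply: (sublinear_dominated (s := s)) => // y ys.
  (* The choice [u = 0] bounds [P y] by [q y], which is 0 on the common kernel of [s]. *)
  apply: le_trans (QP y) _; have := Ple y 0; rewrite subr0 sublinear0// add0r.
  move=> /le_trans; apply; rewrite /q big_seq big1 ?mulr0// => f /ys ->.
  by rewrite normr0.
exists g; split => // [y|].
  apply: le_trans (gQ y) _; apply: le_trans (QP y) _.
  by have := Ple y y; rewrite subrr sublinear0// addr0.
have := gQ (- 1 *: x); rewrite Qx.
have [h gh] := linear_packed (linF g Fg).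
by rewrite gh scaleN1r linearN /= => ?; move: Px; rewrite /b; lra.
Qed.

End separation.

(** * Slices of the sphere: from rotundity to a symmetric, and from a symmetric to a diagonal
    sequence *)

Section slices.
Context {R : realType} {X : normedModType R}.
Implicit Types (N : X -> R) (F : set (X -> R^o)).

Lemma sigma_sphere_val F N (p : sigma_sphere F N) : N (set_val p) = 1.
Proof. exact: set_mem (valP p). Qed.

Lemma sphere_slice_half_space F N f (a : R) : F f -> f <> (fun=> 0) ->
  sphere_slice [set p : sigma_sphere F N | a < f (set_val p)].
Proof.
move=> Ff f0; exists f, a; split => //; apply/seteqP; split=> [x [p ap <-]|x [Sx ax]].
  by split => //; exact: sigma_sphere_val.
by exists (SigSub (mem_set Sx)).
Qed.

Lemma sphere_slice_open F N (D : set (sigma_sphere F N)) :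
  sphere_slice D -> open D.
Proof.
move=> [f [a [Ff _ DE]]].
have -> : D = (set_val : sigma_sphere F N -> sigma_topology F) @^-1`
    ((f : sigma_topology F -> R) @^-1` [set r | a < r]).
  apply/seteqP; split=> [p Dp|p ap].
    by have [] : (sphere N `&` open_half_space f a) (set_val p) by rewrite -DE; exists p.
  have : [set set_val q | q in D] (set_val p).
    by rewrite DE; split => //; exact: sigma_sphere_val.
  by move=> [q Dq /val_inj <-].
apply: open_comp => [p _|].
  exact: (@initial_continuous (sphere N) (sigma_topology F) set_val).
apply: open_comp => [p _|]; first exact: sigma_continuous.
exact: open_gt.
Qed.

Lemma rotund_symmetric F N :
  norming_subspace F -> is_norm N -> sigma_lsc F N -> rotund N ->
  exists rho : sigma_sphere F N -> sigma_sphere F N -> R,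
    symmetric_on rho /\
    forall (x : sigma_sphere F N) (eps : R), 0 < eps ->
      exists D : set (sigma_sphere F N),
        [/\ sphere_slice D, D x & (diam rho D < eps%:E)%E].
Proof.
move=> [Fdual subF _] nN lN rN.
have linF f : F f -> linear f by move=> /Fdual [].
have sN := norm_sublinear nN.
pose rho (p q : sigma_sphere F N) := 1 - N (2^-1 *: (set_val p + set_val q)).
exists rho; split; first split.
- move=> p q; rewrite /rho sN.2// subr_ge0 ler_pdivrMl// mulr1.
  by apply: le_trans (sN.1 _ _) _; rewrite !sigma_sphere_val.
- by move=> p q; rewrite /rho addrC [set_val p + _]addrC addrC.
- move=> p q; split=> [/subr0_eq pq|->].
    by apply/val_inj/rN; [rewrite !sigma_sphere_val|rewrite -pq sigma_sphere_val].
  rewrite /rho -[set_val q]scale1r -scalerDl scalerA.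
  by rewrite -[1 + 1]/(2 : R) mulVf// scale1r sigma_sphere_val subrr.
(* Halving [eps] absorbs the non-strict bound on the supremum; the cap 1/2 keeps [1 - e] positive,
   which forces [f] to be nonzero. *)
move=> p eps eps0; pose e := Num.min (eps / 2) (1 / 2).
have e0 : 0 < e by rewrite lt_min; apply/andP; split; lra.
have eeps : e < eps by rewrite gt_min; apply/orP; left; lra.
have e1 : e < 1 by rewrite gt_min; apply/orP; right; lra.
have : 1 - e < N (set_val p) by rewrite sigma_sphere_val; lra.
move=> /(sigma_lsc_separation subF linF nN lN) [f [Ff fN fp]].
exists [set q : sigma_sphere F N | 1 - e < f (set_val q)]; split => //.
  by apply: sphere_slice_half_space => // f0; move: fp; rewrite f0; lra.
apply: le_lt_trans (_ : (e%:E < eps%:E)%E); last by rewrite lte_fin.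
apply: ge_ereal_sup => _ [q fq [r fr <-]]; rewrite lee_fin /rho.
have := fN (2^-1 *: (set_val q + set_val r)).
have [g fg] := linear_packed (linF f Ff); move: fq fr => /=.
by rewrite fg linearZ linearD /= => ? ? /=; rewrite /GRing.scale/=; lra.
Qed.

Lemma symmetric_Gdelta_diagonal F N
    (rho : sigma_sphere F N -> sigma_sphere F N -> R) :
  symmetric_on rho ->
  (forall (x : sigma_sphere F N) (eps : R), 0 < eps ->
    exists D : set (sigma_sphere F N),
      [/\ sphere_slice D, D x & (diam rho D < eps%:E)%E]) ->
  exists G : nat -> set (set (sigma_sphere F N)),
    Gdelta_diagonal_sequence G /\
    forall n (U : set (sigma_sphere F N)), G n U -> sphere_slice U.
Proof.
move=> [rho0 _ rhoE] Hrho.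
exists (fun n => [set D | sphere_slice D /\ (diam rho D < (n.+1%:R^-1)%:E)%E]).
split=> [|n U []//]; split=> [n|p q pq].
  split=> [D []|]; first by move=> /sphere_slice_open.
  apply/seteqP; split=> // p _.
  have [|D [sD Dp dD]] := Hrho p n.+1%:R^-1; first by rewrite invr_gt0.
  by exists D.
(* If [q] lies in every star of [p], then [rho p q] is below every [1/(n+1)], hence 0. *)
apply: contrapT => /forallNP nst; apply/pq/rhoE/le_anti/andP; split => //.
apply/ler_addgt0Pl => e e0; rewrite addr0.
have [n ne] : exists n, n.+1%:R^-1 < e.
  by exists (Num.truncn e^-1); rewrite invf_plt ?posrE// truncnS_gt.
have /contrapT [D [[sD dD] Dp] Dq] := nst n.
apply/ltW/(lt_trans _ ne); rewrite -lte_fin; apply: le_lt_trans dD.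
by apply: ereal_sup_ubound; exists p => //; exists q.
Qed.

End slices.

(** * Weighted sums of sublinear functions *)

(** For nonnegative [p] this is the sum of the series of the [p i / 2^(i+1)]. As a supremum of
    partial sums, it inherits sublinearity and lower semicontinuity from them. *)
Definition weighted_sup {R : realType} {X : normedModType R}
    (p : nat -> X -> R) (x : X) : R :=
  sup [set \sum_(i < k) 2^-1 ^+ i.+1 * p i x | k in [set: nat]].

Section weighted_sup.
Context {R : realType} {X : normedModType R}.
Variables (N : X -> R) (p : nat -> X -> R) (c : R).
Hypothesis p_ge0 : forall n x, 0 <= p n x.
Hypothesis p_le : forall n x, p n x <= c * N x.
Let S k x := \sum_(i < k) 2^-1 ^+ i.+1 * p i x.

Let weight_gt0 i : 0 < 2^-1 ^+ i.+1 :> R.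
Proof. by rewrite exprn_gt0// invr_gt0. Qed.

Let cN_ge0 x : 0 <= c * N x.
Proof. exact: le_trans (p_ge0 0 x) (p_le 0 x). Qed.

Let S_le k x : S k x <= c * N x.
Proof.
(* The bound is sharpened to the exact sum of the first [k] weights so that induction goes
   through. *)
suff : S k x <= (1 - 2^-1 ^+ k) * (c * N x).
  move=> /le_trans; apply; rewrite ler_piMl// gerBl exprn_ge0// invr_ge0//.
elim: k => [|k IH]; first by rewrite /S big_ord0 expr0 subrr mul0r.
rewrite /S big_ord_recr/= -/(S k x).
have := ler_wpM2l (ltW (weight_gt0 k)) (p_le k x).
rewrite exprS; move: IH; set u := _ ^+ k; lra.
Qed.

Let S_ubound x : has_ubound [set S k x | k in [set: nat]].
Proof. by exists (c * N x) => _ [k _ <-]. Qed.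

Let S_nondecreasing x : {homo S^~ x : k l / (k <= l)%N >-> k <= l}.
Proof.
apply: homo_leq => [//|k l m|k]; first exact: le_trans.
by rewrite /S big_ord_recr/= lerDl mulr_ge0// ltW.
Qed.

Lemma weighted_sup_le x : weighted_sup p x <= c * N x.
Proof. by apply: ge_sup => [|_ [k _ <-]]; [exists (S 0 x), 0|exact: S_le]. Qed.

Let S_le_sup k x : S k x <= weighted_sup p x.
Proof. by apply: ub_le_sup; [exact: S_ubound|exists k]. Qed.

Lemma weighted_sup_ge x : 2^-1 * p 0 x <= weighted_sup p x.
Proof. by apply: le_trans (S_le_sup 1 x); rewrite /S big_ord1 expr1. Qed.

Hypothesis p_sublinear : forall n, sublinear (p n).

Let S_sublinear k : sublinear (S k).
Proof.
split=> [x y|t x t0]; rewrite /S.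
  rewrite -big_split; apply: ler_sum => i _; rewrite /= -mulrDr ler_pM2l//.
  exact: (p_sublinear i).1.
by rewrite mulr_sumr; apply: eq_bigr => i _; rewrite (p_sublinear i).2// mulrCA.
Qed.

Lemma weighted_sup_sublinear : sublinear (weighted_sup p).
Proof.
by apply: sublinear_sup => [|x|k _]; [exists 0%N|exact: S_ubound|exact: S_sublinear].
Qed.

(** All terms are subadditive, so a defect of additivity of [p n] would survive in the sum with its
    positive weight. *)
Lemma weighted_sup_additive x y n :
  weighted_sup p (x + y) = weighted_sup p x + weighted_sup p y ->
  p n (x + y) = p n x + p n y.
Proof.
move=> wxy; apply/le_anti/andP; split; first exact: (p_sublinear n).1.
suff : weighted_sup p (x + y) <=
    weighted_sup p x + weighted_sup p y - 2^-1 ^+ n.+1 * (p n x + p n y - p n (x + y)).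
  by rewrite wxy lerBrDl gerDr pmulr_rle0// subr_le0.
apply: ge_sup => [|_ [k _ <-]]; first by exists (S 0 (x + y)), 0.
(* Partial sums increase, so they may be lengthened to include the term of index [n]. *)
apply: (@le_trans _ _ (S (maxn k n.+1) (x + y))).
  exact/S_nondecreasing/leq_maxl.
apply: (@le_trans _ _ (S (maxn k n.+1) x + S (maxn k n.+1) y
  - 2^-1 ^+ n.+1 * (p n x + p n y - p n (x + y)))); last first.
  by rewrite lerD2r lerD.
have nk : (n < maxn k n.+1)%N by rewrite leq_max leqnn orbT.
pose S' z := \sum_(i < maxn k n.+1 | i != Ordinal nk) 2^-1 ^+ i.+1 * p i z.
have SE z : S (maxn k n.+1) z = 2^-1 ^+ n.+1 * p n z + S' z.
  by rewrite /S (bigD1 (Ordinal nk)).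
have : S' (x + y) <= S' x + S' y.
  rewrite -big_split; apply: ler_sum => i _; rewrite /= -mulrDr ler_pM2l//.
  exact: (p_sublinear i).1.
rewrite !SE; lra.
Qed.

Lemma weighted_sup_lsc F : (forall n, sigma_lsc F (p n)) ->
  sigma_lsc F (weighted_sup p).
Proof.
move=> lp; apply: sigma_lsc_sup => [|x|k _]; [by exists 0%N|exact: S_ubound|].
elim: k => [|k IH].
  rewrite (_ : (fun x => _) = cst 0); last by apply/funext => x; rewrite big_ord0.
  by apply: sigma_lsc_continuous; exact: cst_continuous.
rewrite (_ : (fun x => _) = (fun x => S k x + 2^-1 ^+ k.+1 * p k x)).
  by apply: sigma_lscD => //; exact: sigma_lscZ.
by apply/funext => x; rewrite big_ord_recr.
Qed.

End weighted_sup.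

(** * The sublinear gauge attached to a family of slices *)

Section slice_gauge.
Context {R : realType} {X : normedModType R}.
Variables (F : set (X -> R^o)) (N : X -> R).
Hypothesis subF : submod_closed [in F].
Hypothesis linF : forall f, F f -> linear f.
Hypothesis nN : is_norm N.
Implicit Types (E : X -> X -> Prop).

(** The bound on the threshold keeps [3 - fa.2] between 1 and 5, so each [f + (3 - a) N] is
    sublinear and at most [6 N]. *)
Definition slice_family E : set ((X -> R^o) * R) :=
  [set fa | [/\ F fa.1, forall x, fa.1 x <= N x, `|fa.2| <= 2 &
    forall x y, N x = 1 -> N y = 1 -> fa.2 < fa.1 x -> fa.2 < fa.1 y -> E x y]].

Definition slice_gauge E (x : X) : R :=
  sup [set fa.1 x + (3 - fa.2) * N x | fa in slice_family E].

(** The slice [0 > 0] is empty. This pair makes the supremum one over a nonempty set and bounds the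
    gauge below by [3 N]. *)
Lemma slice_family0 E : slice_family E (0, 0).
Proof.
have f0 x : (0 : X -> R^o) x = 0 :> R by [].
split=> /= [|x||x y _ _].
- by rewrite -in_setE; case: subF.
- by rewrite f0 is_norm_ge0.
- by rewrite normr0.
- by rewrite f0 ltxx.
Qed.

Let term_le E fa x : slice_family E fa -> fa.1 x + (3 - fa.2) * N x <= 6 * N x.
Proof.
move=> [_ /(_ x) fN]; rewrite ler_norml => /andP[a2 _] _.
suff : (3 - fa.2) * N x <= 5 * N x by lra.
by rewrite ler_wpM2r ?is_norm_ge0//; lra.
Qed.

Let ub E x : has_ubound [set fa.1 x + (3 - fa.2) * N x | fa in slice_family E].
Proof. by exists (6 * N x) => _ [fa Efa <-]; exact (term_le x Efa). Qed.

Lemma slice_gauge_le E x : slice_gauge E x <= 6 * N x.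
Proof.
apply: ge_sup => [|_ [fa Efa <-]]; last exact (term_le x Efa).
by exists ((0 : X -> R^o) x + (3 - 0) * N x), (0, 0) => //; exact: slice_family0.
Qed.

Lemma slice_gauge_ge E fa x : slice_family E fa ->
  fa.1 x + (3 - fa.2) * N x <= slice_gauge E x.
Proof. by move=> Efa; apply: ub_le_sup => //; exists fa. Qed.

Lemma slice_gauge_ge_norm E x : 3 * N x <= slice_gauge E x.
Proof.
have /= := slice_gauge_ge x (slice_family0 E).
have -> : (0 : X -> R^o) x = 0 :> R by [].
by rewrite add0r subr0.
Qed.

Lemma slice_gauge_sublinear E : sublinear (slice_gauge E).
Proof.
apply: sublinear_sup => [|//|fa [Ff _]].
  by exists (0, 0); exact: slice_family0.
rewrite ler_norml => /andP[_ a2] _; have sN := norm_sublinear nN.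
have [g fg] := linear_packed (linF Ff).
have a3 : 0 <= 3 - fa.2 by lra.
split=> [x y|t x t0]; rewrite fg.
  by rewrite linearD/= addrACA lerD2l -mulrDr ler_wpM2l// sN.1.
by rewrite linearZ/= sN.2// mulrDr [t * (_ * _)]mulrCA.
Qed.

Lemma slice_gauge_lsc E : sigma_lsc F N -> sigma_lsc F (slice_gauge E).
Proof.
move=> lN; apply: sigma_lsc_sup => [|//|fa [Ff _]].
  by exists (0, 0); exact: slice_family0.
rewrite ler_norml => /andP[_ a2] _; apply: sigma_lscD.
  by apply: sigma_lsc_continuous; exact: sigma_continuous.
by apply: sigma_lscZ => //; lra.
Qed.

(* A pair [(f, a)] almost attaining the supremum at [x + y] almost attains it
   at [x] and at [y] too, hence [a < f x] and [a < f y]. *)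
Lemma slice_gauge_additive E x y : N x = 1 -> N y = 1 ->
  3 < slice_gauge E x -> 3 < slice_gauge E y ->
  slice_gauge E (x + y) = slice_gauge E x + slice_gauge E y -> E x y.
Proof.
move=> Nx Ny Ex Ey Exy.
(* A pair within [m] of the optimum at [x + y] loses less than [m] at [x] and at [y], so both values
   still exceed 3. *)
pose m := Num.min (slice_gauge E x - 3) (slice_gauge E y - 3).
have mx : m <= slice_gauge E x - 3 by rewrite ge_min lexx.
have my : m <= slice_gauge E y - 3 by rewrite ge_min lexx orbT.
have : slice_gauge E x + slice_gauge E y - m < slice_gauge E (x + y).
  by rewrite Exy gtrBl lt_min !subr_gt0 Ex.
move=> /sup_gt[|_ [[f a] Efa <-]].
  exists ((0 : X -> R^o) (x + y) + (3 - 0) * N (x + y)), (0, 0) => //.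
  exact: slice_family0.
have := slice_gauge_ge x Efa; have := slice_gauge_ge y Efa.
have [/= Ff _ a2 fE] := Efa.
have [g fg] := linear_packed (linF Ff); rewrite Nx Ny !mulr1.
have -> : f (x + y) = f x + f y by rewrite fg linearD.
have : (3 - a) * N (x + y) <= (3 - a) * (1 + 1).
  rewrite ler_wpM2l//; first by move: a2; rewrite ler_norml => /andP[]; lra.
  by rewrite -{1}Nx -Ny; exact: (norm_sublinear nN).1.
by move=> *; apply: fE => //; lra.
Qed.

(** Dividing by [C] normalizes [f]. The pair obtained contributes [3 + (C^-1 * f x - b)] at [x],
    with [b < C^-1 * f x]. *)
Lemma slice_gauge_gt E f (a C : R) x : 0 < C -> (forall y, f y <= C * N y) ->
  F f -> N x = 1 -> a < f x ->
  (forall y z, N y = 1 -> N z = 1 -> a < f y -> a < f z -> E y z) ->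
  3 < slice_gauge E x.
Proof.
move=> C0 fC Ff Nx afx Eaf.
(* Raising the threshold only shrinks the slice; the second entry is at least -2, since
   [C^-1 * f x >= -1] on the sphere. *)
pose b := Num.max (C^-1 * a) (C^-1 * f x - 1).
have fx1 : C^-1 * f x <= 1 by rewrite ler_pdivrMl// mulr1 -[leRHS]mulr1 -Nx.
have fxN1 : - 1 <= C^-1 * f x.
  have [g fg] := linear_packed (linF Ff).
  rewrite ler_pdivlMl// mulrN1 lerNl.
  have -> : - f x = f (- x) by rewrite fg linearN.
  by rewrite -[leRHS]mulr1 -Nx -(is_normN x nN).
have bfx : b < C^-1 * f x by rewrite gt_max ltr_pM2l ?invr_gt0// afx gtrBl ltr01.
have ab y : b < C^-1 * f y -> a < f y.
  by rewrite gt_max ltr_pM2l ?invr_gt0// => /andP[].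
have Efb : slice_family E (C^-1 *: f, b).
  split=> /= [|y||y z Ny Nz by_ bz].
  - have := subF.2 C^-1 f 0; rewrite addr0 !in_setE; apply => //.
    by rewrite -in_setE; case: subF.
  - by rewrite [leLHS]/(C^-1 * f y) ler_pdivrMl.
  - rewrite ler_norml; apply/andP; split; last by lra.
    by rewrite /b le_max; apply/orP; right; lra.
  - by apply: Eaf => //; exact: ab.
have := slice_gauge_ge x Efb; apply: lt_le_trans.
have -> : (C^-1 *: f, b).1 x = C^-1 * f x :> R by [].
by rewrite /= Nx mulr1; lra.
Qed.

End slice_gauge.

(** * Construction of the rotund norm from the covers by slices *)

(* The relation [E n] stands for "some slice of the [n]-th cover contains both
   points". *)
Lemma rotund_renorming {R : realType} {X : normedModType R}
    (F : set (X -> R^o)) (N : X -> R) (E : nat -> X -> X -> Prop) :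
  F `<=` dual -> submod_closed [in F] -> equivalent_norm N -> sigma_lsc F N ->
  (forall n x, N x = 1 -> exists f (a : R), [/\ F f, a < f x &
    forall y z, N y = 1 -> N z = 1 -> a < f y -> a < f z -> E n y z]) ->
  (forall x y, N x = 1 -> N y = 1 -> (forall n, E n x y) -> x = y) ->
  exists M : X -> R, [/\ equivalent_norm M, sigma_lsc F M & rotund M].
Proof.
move=> Fdual subF [nN [c [C [c0 C0 cNC]]]] lN covE sepE.
have linF f : F f -> linear f by move=> /Fdual [].
pose p n := slice_gauge F N (E n); pose w := weighted_sup p.
have N0 x : 0 <= N x by exact: is_norm_ge0.
have pN n x : 3 * N x <= p n x by exact: slice_gauge_ge_norm.
have p0 n x : 0 <= p n x by apply: le_trans (pN n x); rewrite mulr_ge0.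
have p6 n x : p n x <= 6 * N x by exact: slice_gauge_le.
have sp n : sublinear (p n) by exact: slice_gauge_sublinear.
have sw : sublinear w := weighted_sup_sublinear p0 p6 sp.
have w6 x : w x <= 6 * N x := weighted_sup_le p0 p6 x.
have wN x : N x <= w x.
  have := weighted_sup_ge p0 p6 x; have := pN 0%N x; have := N0 x.
  by rewrite -/w; lra.
(* The gauges need not be even. From [N <= w <= 6 N] one gets [2 N <= M <= 12 N]. *)
pose M x := w x + w (- x).
have MN x : 2 * N x <= M x.
  by have := wN x; have := wN (- x); rewrite (is_normN x nN) /M; lra.
have MD x y : M (x + y) <= M x + M y.
  by rewrite /M opprD; have := sw.1 x y; have := sw.1 (- x) (- y); lra.
have MZ (a : R) x : M (a *: x) = `|a| * M x.
  rewrite /M; have [a0|a0] := leP 0 a; first by rewrite ger0_norm// -scalerN !sw.2// mulrDr.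
  have aN0 : 0 <= - a by rewrite oppr_ge0 ltW.
  have -> : a *: x = - a *: - x by rewrite scaleNr scalerN opprK.
  by rewrite ltr0_norm// -scalerN opprK !sw.2// -mulrDr addrC.
have nM : is_norm M.
  split=> // x Mx; have [_ _] := nN; apply; apply/le_anti.
  by rewrite N0 andbT; have := MN x; rewrite Mx; lra.
exists M; split.
- split=> //; exists c, (12 * C); split=> // [|x]; first by rewrite mulr_gt0.
  have /andP[cx Cx] := cNC x; apply/andP; split.
    by have := MN x; have := N0 x; lra.
  have -> : 12 * C * `|x| = 12 * (C * `|x|) by rewrite mulrA.
    by have := w6 x; have := w6 (- x); rewrite (is_normN x nN) /M; lra.
- apply: sigma_lscD; first by apply: weighted_sup_lsc => // n; exact: slice_gauge_lsc.
  apply: (@sigma_lscN _ _ _ w) => //.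
  by apply: weighted_sup_lsc => // n; exact: slice_gauge_lsc.
move=> x y Mxy; rewrite MZ ger0_norm// => Mmid.
have [x0|xn0] := eqVneq (M x) 0.
  by have [_ _ M0] := nM; rewrite (M0 x)// (M0 y)// -Mxy.
have Npos z : M z = M x -> 0 < N z.
  move=> Mz; rewrite lt_neqAle N0 andbT; apply/eqP => /esym Nz.
  have [_ _ Nz0] := nN; move: xn0; rewrite -Mz (Nz0 z Nz).
  by rewrite /M oppr0 sublinear0// addr0 eqxx.
(* Equality at the midpoint makes [M] additive at [x, y], hence also each of its two subadditive
   summands. *)
have wxy : w (x + y) = w x + w y.
  apply/le_anti/andP; split; first exact: sw.1.
  have := sw.1 (- x) (- y); move: Mmid; rewrite -Mxy -opprD => Mmid.
  have : M (x + y) = M x + M y by lra.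
  by rewrite /M; lra.
have Nx := Npos x erefl; have Ny := Npos y (esym Mxy).
have N1 z : 0 < N z -> N ((N z)^-1 *: z) = 1.
  by move=> Nz; have [_ -> _] := nN; rewrite gtr0_norm ?invr_gt0// mulVf// gt_eqF.
(* The covers only see the [N]-sphere, so they identify the directions of [x] and [y]; [M x = M y]
   then fixes the length. *)
have xy : (N x)^-1 *: x = (N y)^-1 *: y.
  apply: sepE; [exact: N1|exact: N1|move=> n].
  have pgt z : N z = 1 -> 3 < p n z.
    move=> Nz; have [f [a [Ff af fE]]] := covE n z Nz.
    have [B B0 fB] : exists2 B, 0 < B & forall u, f u <= B * N u.
      have [B B0 fB] := dual_bounded (Fdual f Ff).
      exists (B / c) => [|u]; first by rewrite divr_gt0.
      have /andP[cu _] := cNC u; apply: le_trans (ler_norm _) _.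
      by apply: le_trans (fB u) _; rewrite -mulrA ler_pM2l// ler_pdivlMl.
    exact: (slice_gauge_gt subF linF nN _ fB Ff Nz af fE).
  apply: (slice_gauge_additive subF linF nN); rewrite ?N1//; [exact/pgt/N1|exact/pgt/N1|].
  have pxy := weighted_sup_additive p0 p6 sp n wxy.
  rewrite -/(p n) (sublinear_additive_cone _ pxy) ?invr_ge0//.
  by rewrite !(sp n).2 ?invr_ge0.
pose l := N x / N y.
have xE : x = l *: y.
  by rewrite /l -scalerA -xy scalerA divff ?scale1r// gt_eqF.
have l0 : 0 <= l by rewrite divr_ge0.
suff -> : x = y by [].
have : M x = l * M x by rewrite {1}xE MZ ger0_norm// -Mxy.
rewrite -[LHS]mul1r => /(mulIf xn0) l1.
by rewrite xE -l1 scale1r.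
Qed.

Lemma Gdelta_diagonal_rotund {R : realType} {X : normedModType R}
    (F : set (X -> R^o)) (N : X -> R) (G : nat -> set (set (sigma_sphere F N))) :
  norming_subspace F -> equivalent_norm N -> sigma_lsc F N ->
  Gdelta_diagonal_sequence G ->
  (forall n (U : set (sigma_sphere F N)), G n U -> sphere_slice U) ->
  exists M : X -> R, [/\ equivalent_norm M, sigma_lsc F M & rotund M].
Proof.
move=> [Fdual subF _] eN lN [coverG diagG] sliceG.
pose E n x y := exists2 U, G n U & [set set_val p | p in U] x /\ [set set_val p | p in U] y.
apply: (@rotund_renorming _ _ F N E) => // [n x Nx|x y Nx Ny Exy].
  pose q : sigma_sphere F N := SigSub (mem_set Nx : x \in sphere N).
  have [_ /seteqP[_ /(_ q I) [U GU Uq]]] := coverG n.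
  have [f [a [Ff f0 UE]]] := sliceG n U GU.
  have SU z : N z = 1 -> a < f z -> [set set_val p | p in U] z by move=> Nz az; rewrite UE.
  exists f, a; split=> // [|y z Ny Nz ay az].
    by have [] : (sphere N `&` open_half_space f a) x by rewrite -UE; exists q.
  by exists U => //; split; exact: SU.
pose q z (Nz : N z = 1) : sigma_sphere F N := SigSub (mem_set Nz : z \in sphere N).
(* A star separating the two points would contradict [Exy] at the same index. *)
suff : q x Nx = q y Ny by move=> /(congr1 set_val).
apply: contrapT => /diagG [n]; apply.
have [U GU [[r Ur rx] [s Us sy]]] := Exy n.
by exists U; [split => //; rewrite (_ : q x Nx = r)//; exact: val_inj|
  rewrite (_ : q y Ny = s)//; exact: val_inj].
Qed.

(** * The equivalence as a cycle of three implications *)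

Unset Implicit Arguments.

Theorem theorem1p3 (R : realType) (X : completeNormedModType R)
    (F : set (X -> R^o)) (hF : norming_subspace F) :
  [<-> (* (i) *)
       exists N : X -> R,
         [/\ equivalent_norm N, sigma_lsc F N & rotund N];
       (* (ii) *)
       exists N : X -> R,
         [/\ equivalent_norm N, sigma_lsc F N &
             exists rho : sigma_sphere F N -> sigma_sphere F N -> R,
               symmetric_on rho /\
               forall (x : sigma_sphere F N) (eps : R), 0 < eps ->
                 exists D : set (sigma_sphere F N),
                   [/\ sphere_slice D, D x & (diam rho D < eps%:E)%E]];
       (* (iii) *)
       exists N : X -> R,
         [/\ equivalent_norm N, sigma_lsc F N &
             exists G : nat -> set (set (sigma_sphere F N)),
               Gdelta_diagonal_sequence G /\
               forall n (U : set (sigma_sphere F N)), G n U -> sphere_slice U]].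
Proof.
have [Fdual subF _] := hF.
tfae.
- move=> [N [eN lN rN]]; exists N; split=> //.
  by apply: rotund_symmetric => //; exact: eN.1.
- move=> [N [eN lN [rho [srho Hrho]]]]; exists N; split=> //.
  exact: symmetric_Gdelta_diagonal Hrho.
- by move=> [N [eN lN [G [dG sG]]]]; exact: Gdelta_diagonal_rotund sG.
Qed.
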